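(* Let $A, B$ be two disjoint linked Jordan curves in the unit $3$-sphere $\mathbf{S}^3$. Then $$\operatorname{d}(A,B)\le \pi/2,$$ and equality holds if and only if $A$ and $B$ are dual great circles in the Hopf fibration, i.e. there is a $2$-dimensional real linear subspace $P\subset\mathbb{C}^2=\mathbb{R}^4$ such that $A=\mathbf{S}^3\cap P$ and $B=\mathbf{S}^3\cap P^{\perp}$.
   Context: $\mathbf{S}^3=\{(z_1,z_2)\in\mathbb{C}^2 : |z_1|^2+|z_2|^2=1\}$ is the unit $3$-sphere with its round metric of constant curvature $1$, and $\operatorname{d}(A,B)=\inf\{\operatorname{d}(a,b): a\in A,\ b\in B\}$, where $\operatorname{d}(a,b)$ is the geodesic (angular) distance. Linked: subsets $A,B\subset\mathbf{S}^n$ are called unlinked if there exists an embedded $(n-1)$-sphere $S$ in $\mathbf{S}^n$ such that $A$ and $B$ lie in complementary ''hemispheres'' determined by $S$, i.e. in the two different connected components of $\mathbf{S}^n\setminus S$; otherwise $A$ and $B$ are called linked. Here $n=3$. *)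

(* Defs.v *)
From HB Require Import structures.
From mathcomp Require Import all_boot all_order all_algebra.
From mathcomp Require Import all_classical all_reals all_analysis.

Set Implicit Arguments.
Unset Strict Implicit.
Unset Printing Implicit Defensive.

Import Order.TTheory GRing.Theory Num.Theory.
Import numFieldNormedType.Exports.

Local Open Scope classical_set_scope.
Local Open Scope ring_scope.

(* The library's norm on 'rV[R]_n is the max norm. It induces the usual
   topology of R^n, but Euclidean lengths and angles are defined here from the
   dot product. *)
Definition dot (R : realType) (n : nat) (x y : 'rV[R]_n) : R :=
  \sum_(i < n) x 0 i * y 0 i.

Definition usphere (R : realType) (n : nat) : set 'rV[R]_n.+1 :=
  [set x | dot x x = 1].
Arguments usphere : clear implicits.

(* C^2 is identified with R^4 by (z_1, z_2) |-> (Re z_1, Im z_1, Re z_2, Im z_2),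
   so that S^3 is [usphere R 3]. *)

Definition orthocomp (R : realType) (n : nat) (P : {vspace 'rV[R]_n}) :
    set 'rV[R]_n :=
  [set y | forall x, x \in P -> dot x y = 0].

(* Angular distance between points of the unit sphere. *)
Definition angdist (R : realType) (n : nat) (x y : 'rV[R]_n) : R :=
  acos (dot x y).

Definition setdist (R : realType) (n : nat) (A B : set 'rV[R]_n) : R :=
  inf [set r | exists a b, [/\ A a, B b & r = angdist a b]].

(* [f] restricts to a homeomorphism from [K] onto [f @` K] (subspace topologies);
   [g] is the inverse homeomorphism. *)
Definition embedding_on (T U : topologicalType) (K : set T) (f : T -> U) : Prop :=
  {within K, continuous f} /\
  exists g : U -> T,
    (forall x, K x -> g (f x) = x) /\ {within f @` K, continuous g}.

(* [S] is a topologically embedded k-sphere contained in S^n. *)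
Definition embedded_sphere (R : realType) (k n : nat) (S : set 'rV[R]_n.+1) :
    Prop :=
  S `<=` usphere R n /\
  exists f : 'rV[R]_k.+1 -> 'rV[R]_n.+1,
    embedding_on (usphere R k) f /\ f @` usphere R k = S.

Definition jordan_curve (R : realType) (n : nat) (A : set 'rV[R]_n.+1) : Prop :=
  embedded_sphere 1 A.

Definition is_component (T : topologicalType) (X C : set T) : Prop :=
  exists2 x, X x & C = connected_component X x.

(* [A] and [B] are meant to be subsets of S^n, with n > 0. *)
Definition unlinked (R : realType) (n : nat) (A B : set 'rV[R]_n.+1) : Prop :=
  exists S : set 'rV[R]_n.+1,
    embedded_sphere n.-1 S /\
    exists C D : set 'rV[R]_n.+1,
      [/\ is_component (usphere R n `\` S) C,
          is_component (usphere R n `\` S) D,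
          C <> D, A `<=` C & B `<=` D].

Definition linked (R : realType) (n : nat) (A B : set 'rV[R]_n.+1) : Prop :=
  ~ unlinked A B.

(* Main.v *)
Require Import Defs.
From mathcomp Require Import all_boot all_order all_algebra finmap.
From mathcomp Require Import all_classical all_reals all_analysis.
From mathcomp Require Import ring lra.

Set Implicit Arguments.
Unset Strict Implicit.
Unset Printing Implicit Defensive.

Import Order.TTheory GRing.Theory Num.Theory.
Import numFieldNormedType.Exports.

Local Open Scope classical_set_scope.
Local Open Scope ring_scope.

(** If the distance from A to B is at least pi/2, then a.b <= 0 for all a in A
    and b in B. It is shown that two Jordan curves in S^3 with this property are
    either dual great circles, whose distance is exactly pi/2, or unlinked; both
    halves of the theorem follow.

    The spheres that unlink are graphs over a great sphere. For a unit vector w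
    and a continuous, positively homogeneous function H of the component of x
    orthogonal to w, the set of points of S^n with x.w = H(x) meets each half
    great circle from -w to w exactly once, hence is an embedded (n-1)-sphere,
    and its two sides x.w > H(x) and x.w < H(x) are the components of its
    complement ([unlinked_graph]).

    Suppose first that A lies in an open half space. As a.b <= 0, the half space
    can be chosen to be x.w > 0 with B in x.w <= 0 ([polar_functional]), and a
    small multiple of the norm of the component orthogonal to w serves as H
    ([half_space_unlinked]).

    Suppose now that neither A nor B lies in an open half space. Let A' be the
    set of points of A orthogonal to all of B, and B' the set of points of B
    orthogonal to all of A. A linear form that is positive on A' becomes
    positive on A after adding large multiples of the forms -x.b, which are
    nonnegative on A and vanish together only on A' ([perp_half_space]). So A'
    and B' are not empty.

    If B' contains two linearly independent vectors, then A lies in the great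
    circle orthogonal to both. A Jordan curve in a circle is the whole circle
    ([jordan_curve_circle]): otherwise stereographic projection from a missing
    point would make it an injective real function on the circle, against the
    Borsuk-Ulam theorem in dimension one. Thus A = -A, so a.b = 0 throughout, B
    lies in the dual circle and is equal to it ([dual_circles_of_perp]). The
    case of two independent vectors in A' is symmetric.

    What remains is that A' lies in {a, -a} and B' in {b, -b}, with a.b = 0. The
    part of A orthogonal to a has no point orthogonal to B, so by the argument
    above it lies in an open half space; the same holds for the part of B
    orthogonal to b, and the two parts can be separated strictly by a vector w
    orthogonal to a and b. The function H(x) = M (|x.b| - |x.a|) is negative on
    A and positive on B away from these parts, and for large M its sphere
    separates A from B ([poles_unlinked]). *)

(** * Euclidean geometry of row vectors *)

Lemma dotE (R : realType) (n : nat) (x y : 'rV[R]_n) :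
  dot x y = (x *m y^T) 0 0.
Proof. by rewrite mxE; apply: eq_bigr => i _; rewrite mxE. Qed.

Lemma dotC (R : realType) (n : nat) (x y : 'rV[R]_n) : dot x y = dot y x.
Proof. by apply: eq_bigr => i _; rewrite mulrC. Qed.

Lemma dotDl (R : realType) (n : nat) (x y z : 'rV[R]_n) :
  dot (x + y) z = dot x z + dot y z.
Proof. by rewrite !dotE mulmxDl mxE. Qed.

Lemma dotZl (R : realType) (n : nat) (k : R) (x y : 'rV[R]_n) :
  dot (k *: x) y = k * dot x y.
Proof. by rewrite !dotE -scalemxAl mxE. Qed.

Lemma dotNl (R : realType) (n : nat) (x y : 'rV[R]_n) :
  dot (- x) y = - dot x y.
Proof. by rewrite -scaleN1r dotZl mulN1r. Qed.

Lemma dot0l (R : realType) (n : nat) (x : 'rV[R]_n) : dot 0 x = 0.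
Proof. by rewrite -(scale0r x) dotZl mul0r. Qed.

Lemma dotBl (R : realType) (n : nat) (x y z : 'rV[R]_n) :
  dot (x - y) z = dot x z - dot y z.
Proof. by rewrite dotDl dotNl. Qed.

Lemma dotDr (R : realType) (n : nat) (x y z : 'rV[R]_n) :
  dot x (y + z) = dot x y + dot x z.
Proof. by rewrite dotC dotDl !(dotC x). Qed.

Lemma dotZr (R : realType) (n : nat) (k : R) (x y : 'rV[R]_n) :
  dot x (k *: y) = k * dot x y.
Proof. by rewrite dotC dotZl dotC. Qed.

Lemma dotNr (R : realType) (n : nat) (x y : 'rV[R]_n) :
  dot x (- y) = - dot x y.
Proof. by rewrite dotC dotNl dotC. Qed.

Lemma dotBr (R : realType) (n : nat) (x y z : 'rV[R]_n) :
  dot x (y - z) = dot x y - dot x z.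
Proof. by rewrite dotDr dotNr. Qed.

Lemma dot_suml (R : realType) (n : nat) (I : Type) (r : seq I)
    (F : I -> 'rV[R]_n) (y : 'rV[R]_n) :
  dot (\sum_(i <- r) F i) y = \sum_(i <- r) dot (F i) y.
Proof.
elim: r => [|i r IH]; first by rewrite !big_nil dot0l.
by rewrite !big_cons dotDl IH.
Qed.

Lemma dot_ge0 (R : realType) (n : nat) (x : 'rV[R]_n) : 0 <= dot x x.
Proof. by apply: sumr_ge0 => i _; rewrite -expr2 sqr_ge0. Qed.

Lemma dot_eq0 (R : realType) (n : nat) (x : 'rV[R]_n) :
  (dot x x == 0) = (x == 0).
Proof.
apply/idP/eqP => [|->]; last by rewrite dot0l.
rewrite psumr_eq0 => [|i _]; last by rewrite -expr2 sqr_ge0.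
move=> /allP h; apply/rowP => i; rewrite mxE.
by have /= := h i (mem_index_enum _); rewrite mulf_eq0 orbb => /eqP.
Qed.

Lemma dot_gt0 (R : realType) (n : nat) (x : 'rV[R]_n) :
  (0 < dot x x) = (x != 0).
Proof. by rewrite lt0r dot_eq0 dot_ge0 andbT. Qed.

Definition unitize (R : realType) (n : nat) (x : 'rV[R]_n) : 'rV[R]_n :=
  (Num.sqrt (dot x x))^-1 *: x.

Lemma sqrt_dot_gt0 (R : realType) (n : nat) (x : 'rV[R]_n) :
  x != 0 -> 0 < Num.sqrt (dot x x).
Proof. by rewrite sqrtr_gt0 dot_gt0. Qed.

Lemma dot_unitize (R : realType) (n : nat) (x : 'rV[R]_n) :
  x != 0 -> dot (unitize x) (unitize x) = 1.
Proof.
move=> x0; rewrite dotZl dotZr -{3}(sqr_sqrtr (dot_ge0 x)).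
by have := lt0r_neq0 (sqrt_dot_gt0 x0); move: (Num.sqrt _) => r r0; field.
Qed.

Lemma unitizeZ (R : realType) (n : nat) (k : R) (x : 'rV[R]_n) :
  0 < k -> unitize (k *: x) = unitize x.
Proof.
move=> k0; rewrite /unitize dotZl dotZr mulrA -expr2 sqrtrM ?sqr_ge0//.
rewrite sqrtr_sqr gtr0_norm// scalerA invfM [k^-1 * _]mulrC -mulrA mulVf ?mulr1//.
exact: lt0r_neq0.
Qed.

Lemma unitize_id (R : realType) (n : nat) (x : 'rV[R]_n) :
  dot x x = 1 -> unitize x = x.
Proof. by rewrite /unitize => ->; rewrite sqrtr1 invr1 scale1r. Qed.

Lemma usphere_neq0 (R : realType) (n : nat) (x : 'rV[R]_n) :
  dot x x = 1 -> x != 0.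
Proof. by rewrite -dot_gt0 => ->. Qed.

Lemma usphere_dot_itv (R : realType) (n : nat) (x y : 'rV[R]_n) :
  dot x x = 1 -> dot y y = 1 -> -1 <= dot x y <= 1.
Proof.
move=> x1 y1; have := dot_ge0 (x + y); have := dot_ge0 (x - y).
rewrite dotBl !dotBr dotDl !dotDr (dotC y x) x1 y1 => ? ?.
by apply/andP; split; lra.
Qed.

(** * Continuity and compactness for the dot product *)

Lemma cvg_sumr (R : realType) (I T : Type) (r : seq I) (F : set_system T)
    {FF : Filter F} (f : I -> T -> R) (l : I -> R) :
  (forall i, f i @ F --> l i) ->
  (fun x => \sum_(i <- r) f i x) @ F --> \sum_(i <- r) l i.
Proof.
move=> fl; elim: r => [|i r IH].
  by rewrite big_nil; under eq_fun do rewrite big_nil; exact: cvg_cst.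
by rewrite big_cons; under eq_fun do rewrite big_cons; exact: cvgD.
Qed.

Lemma cvg_mx_coord (R : realType) (m n : nat) (T : Type) (F : set_system T)
    {FF : Filter F} (f : T -> 'M[R]_(m, n)) (M : 'M[R]_(m, n)) :
  (forall i j, (fun x => f x i j) @ F --> M i j) -> f @ F --> M.
Proof.
move=> cf A [P MP PA].
suff FP : F [set x | forall ij : 'I_m * 'I_n, P ij.1 ij.2 (f x ij.1 ij.2)].
  change (F (f @^-1` A)); apply: (@filterS _ F _ _ _ _ FP) => x /= Px.
  by apply: PA => i j; exact: (Px (i, j)).
apply: (filter_forall (f := fun (ij : 'I_m * 'I_n) x =>
    P ij.1 ij.2 (f x ij.1 ij.2))) => -[i j].
by apply: cf; exact: MP.
Qed.

Lemma mulmxr_continuous (R : realType) (m n : nat) (B : 'M[R]_(m, n)) :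
  continuous (fun x : 'rV[R]_m => x *m B).
Proof.
move=> x; apply: (@cvg_mx_coord _ _ _ _ (nbhs x)) => i j.
have -> : (fun y : 'rV[R]_m => (y *m B) i j) =
    fun y => \sum_k y i k * B k j by apply: funext => y; rewrite mxE.
have -> : (x *m B) i j = \sum_k x i k * B k j by rewrite mxE.
apply: cvg_sumr => k; apply: cvgM; last exact: cvg_cst.
exact: coord_continuous.
Qed.

Lemma dot_cvg (R : realType) (n : nat) (T : Type) (F : set_system T)
    {FF : Filter F} (f g : T -> 'rV[R]_n) (a b : 'rV[R]_n) :
  f @ F --> a -> g @ F --> b -> (fun x => dot (f x) (g x)) @ F --> dot a b.
Proof.
move=> fa gb; apply: cvg_sumr => i.
apply: cvgM.
  exact: (cvg_comp _ _ fa (@coord_continuous _ _ _ 0 i a)).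
exact: (cvg_comp _ _ gb (@coord_continuous _ _ _ 0 i b)).
Qed.

Lemma unitize_cvg (R : realType) (n : nat) (T : Type) (F : set_system T)
    {FF : Filter F} (f : T -> 'rV[R]_n) (a : 'rV[R]_n) :
  a != 0 -> f @ F --> a -> (fun x => unitize (f x)) @ F --> unitize a.
Proof.
move=> a0 fa.
have sf : (fun x => Num.sqrt (dot (f x) (f x))) @ F --> Num.sqrt (dot a a).
  exact: (cvg_comp _ _ (dot_cvg fa fa) (@sqrt_continuous _ _)).
by apply: cvgZ fa; exact: (cvgV (lt0r_neq0 (sqrt_dot_gt0 a0)) sf).
Qed.

Lemma dotl_continuous (R : realType) (n : nat) (w : 'rV[R]_n) :
  continuous (fun x => dot x w).
Proof. move=> x; apply: (@dot_cvg _ _ _ (nbhs x) _ id (cst w) x w).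
  exact: cvg_id.
exact: cvg_cst. Qed.

Lemma sqnorm_continuous (R : realType) (n : nat) :
  continuous (fun x : 'rV[R]_n => dot x x).
Proof.
by move=> x; apply: (@dot_cvg _ _ _ (nbhs x) _ id id x x); exact: cvg_id.
Qed.

Lemma dot_ball_compact (R : realType) (n : nat) (r : R) :
  compact [set x : 'rV[R]_n | dot x x <= r].
Proof.
have cube : compact
    [set v : 'rV[R]_n | forall i, `[(- (r + 1) : R), r + 1]%classic (v ord0 i)].
  apply: (@rV_compact R _ (fun=> `[- (r + 1), r + 1]%classic)) => _.
  exact: segment_compact.
apply: subclosed_compact cube _.
  rewrite (_ : mkset _ = (fun x => dot x x) @^-1` [set y | y <= r])//.
  by apply: preimage_closed => [x _|]; [exact: sqnorm_continuous|exact: closed_le].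
move=> x /= xr i; rewrite in_itv/= -ler_norml.
have r0 : 0 <= r by exact: le_trans (dot_ge0 x) xr.
rewrite -(@ler_pXn2r _ 2) ?nnegrE ?addr_ge0//.
apply: (@le_trans _ _ (dot x x)); last by apply: (le_trans xr); nra.
rewrite /dot (bigD1 i)//= real_normK ?num_real// -expr2 lerDl.
by apply: sumr_ge0 => j _; rewrite -expr2 sqr_ge0.
Qed.

Lemma usphere_compact (R : realType) (n : nat) : compact (usphere R n).
Proof.
apply: subclosed_compact (@dot_ball_compact R n.+1 1) _ => [|x /= ->//].
rewrite (_ : usphere R n = (fun x => dot x x) @^-1` [set 1])//.
by apply: preimage_closed => [x _|]; [exact: sqnorm_continuous|exact: closed_eq].
Qed.

(** * Half spaces and compact sets of nonpositive dot products *)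

(** Penalty method: a large enough multiple of the nonnegative functions g_i
    compensates for the negative values of f, because f is positive on their
    common zero set. The open sets f + m g_i > 0 cover K, and on a finite
    subcover the terms of the other pairs (i, m) only add nonnegative values. *)
Lemma compact_penalty (R : realType) (T : ptopologicalType) (K : set T)
    (I : choiceType) (P : set I) (f : T -> R) (g : I -> T -> R) :
  P !=set0 -> compact K -> continuous f -> (forall i, P i -> continuous (g i)) ->
  (forall i x, P i -> K x -> 0 <= g i x) ->
  (forall x, K x -> (forall i, P i -> g i x = 0) -> 0 < f x) ->
  exists2 D : seq (I * nat), (forall d, d \in D -> P d.1) &
    forall x, K x -> 0 < f x + \sum_(d <- D) d.2%:R * g d.1 x.
Proof.
move=> [i0 Pi0]; rewrite compact_cover => cK cf cg g_ge0 f_gt0.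
pose O (d : I * nat) := [set x | 0 < f x + d.2%:R * g d.1 x].
have oO d : [set d | P d.1] d -> open (O d).
  move=> Pd; rewrite (_ : O d =
    (fun x => f x + d.2%:R * g d.1 x) @^-1` [set y | 0 < y])//.
  apply: open_comp; last exact: open_gt.
  move=> x _; apply: cvgD; first exact: cf.
  by apply: cvgMl_tmp; exact: cg.
have covK : K `<=` cover [set d | P d.1] O.
  move=> x Kx.
  have [[i Pi gx]|gx0] := pselect (exists2 i, P i & g i x != 0).
    have gi0 : 0 < g i x by rewrite lt0r gx g_ge0.
    exists (i, (Num.truncn (- f x / g i x)).+1) => //; rewrite /O/= addrC -ltrBlDr sub0r.
    rewrite -ltr_pdivrMr//.
    exact: truncnS_gt.
  exists (i0, 0%N) => //; rewrite /O/= mul0r addr0; apply: f_gt0 => // i Pi.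
  by apply/eqP/negP => /negP gx; apply: gx0; exists i.
have [D DP KD] := cK _ _ _ oO covK.
exists D => [d /DP/[!inE]//|x Kx].
have [d Dd xd] := KD x Kx; apply: (lt_le_trans xd); rewrite lerD2l.
rewrite (big_rem d)//= lerDl big_seq; apply: sumr_ge0 => e /mem_rem De.
by apply: mulr_ge0 => //; apply: g_ge0 => //; have /[!inE] := DP _ De.
Qed.

Lemma compact_penalty1 (R : realType) (T : ptopologicalType) (K : set T)
    (f g : T -> R) :
  compact K -> continuous f -> continuous g -> (forall x, K x -> 0 <= g x) ->
  (forall x, K x -> g x = 0 -> 0 < f x) ->
  exists2 M : R, 0 <= M & forall x, K x -> 0 < f x + M * g x.
Proof.
move=> cK cf cg g_ge0 f_gt0.
have [||||||D _ KD] := @compact_penalty R T K unit setT f (fun=> g) => //.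
- by exists tt.
- by move=> i x _; exact: g_ge0.
- by move=> x Kx /(_ tt Logic.I); exact: f_gt0.
exists (\sum_(d <- D) d.2%:R) => [|x Kx]; first by apply: sumr_ge0.
by rewrite mulr_suml; exact: KD.
Qed.

Lemma closed_dotl_le0 (R : realType) (n : nat) (w : 'rV[R]_n) :
  closed [set x | dot x w <= 0].
Proof.
rewrite (_ : mkset _ = (fun x => dot x w) @^-1` [set y | y <= 0])//.
by apply: preimage_closed => [x _|]; [exact: dotl_continuous|exact: closed_le].
Qed.

Lemma closed_dotl_ge (R : realType) (n : nat) (w : 'rV[R]_n) (r : R) :
  closed [set x | r <= dot x w].
Proof.
rewrite (_ : mkset _ = (fun x => dot x w) @^-1` [set y | r <= y])//.
by apply: preimage_closed => [x _|]; [exact: dotl_continuous|exact: closed_ge].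
Qed.

(** The vector w is the point nearest to the origin of the closed convex set of
    all x with x.y >= min_A (a.y) and x.b <= 0 for b in B. This set contains A
    and misses the origin, so A lies strictly on the far side of the hyperplane
    through the origin orthogonal to w. *)
Lemma polar_functional (R : realType) (n : nat) (A B : set 'rV[R]_n)
    (y : 'rV[R]_n) :
  compact A -> (forall a, A a -> 0 < dot a y) ->
  (forall a b, A a -> B b -> dot a b <= 0) ->
  exists w : 'rV[R]_n,
    (forall a, A a -> 0 < dot a w) /\ (forall b, B b -> dot b w <= 0).
Proof.
move=> cA Ay AB.
have [->|/set0P A0] := eqVneq A set0.
  by exists 0; split=> // b _; rewrite dotC dot0l.
have [a0 /[!inE] Aa0 min0] :=
  EVT_min_rV A0 cA (continuous_subspaceT (@dotl_continuous R n y)).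
pose C := [set x | dot a0 y <= dot x y] `&` \bigcap_(b in B) [set x | dot x b <= 0].
have AC a : A a -> C a.
  by move=> Aa; split=> [|b Bb]; [apply: min0; rewrite inE|exact: AB].
have clC : closed C.
  apply: closedI; first exact: closed_dotl_ge.
  by apply: closed_bigI => b _; exact: closed_dotl_le0.
have cC : compact (C `&` [set x | dot x x <= dot a0 a0]).
  by rewrite setIC; apply: compact_closedI => //; exact: dot_ball_compact.
have [w /[!inE] -[Cw wa0] minw] := EVT_min_rV
  (ex_intro _ a0 (conj (AC _ Aa0) (lexx _))) cC
  (continuous_subspaceT (@sqnorm_continuous R n)).
exists w; split => [a Aa|b Bb]; last by rewrite dotC; exact: Cw.2.
have w_neq0 : w != 0.
  by apply: contraTneq (lt_le_trans (Ay _ Aa0) Cw.1) => ->; rewrite dot0l ltxx.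
rewrite ltNge; apply/negP => aw0.
have w0 : 0 < dot w w by rewrite dot_gt0.
have d0 : 0 < dot (a - w) (a - w).
  rewrite dot_gt0 subr_eq0; apply: contraTneq aw0 => ->.
  by rewrite -ltNge.
(* The squared norm on the line from w to a is least at parameter t; if
   a.w <= 0, this point lies on the segment and is nearer to 0 than w. *)
pose t := (dot w w - dot a w) / dot (a - w) (a - w).
have t0 : 0 <= t by rewrite divr_ge0// ?dot_ge0// subr_ge0 (le_trans aw0)// ltW.
have aa := dot_ge0 a.
have dE : dot (a - w) (a - w) = dot a a - 2 * dot a w + dot w w.
  by rewrite dotBl !dotBr (dotC w a); ring.
have t1 : t <= 1 by rewrite ler_pdivrMr// mul1r dE; lra.
have tE : t * dot (a - w) (a - w) = dot w w - dot a w.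
  by rewrite mulfVK// lt0r_neq0.
pose x := (1 - t) *: w + t *: a.
have Cx : C x.
  split => [|b Bb] /=; rewrite dotDl !dotZl.
    have := (AC _ Aa).1; have := Cw.1 => /= h1 h2; nra.
  have := (AC _ Aa).2 b Bb; have := Cw.2 b Bb => /= h1 h2; nra.
have xw : dot x x < dot w w.
  rewrite dotDl !dotDr !dotZl !dotZr (dotC w a).
  move: tE; rewrite dE.
  have : 0 < t.
    by rewrite /t divr_gt0// subr_gt0 (le_lt_trans aw0).
  move: (dot w w) (dot a w) (dot a a) w0 aw0 aa => p q r; nra.
have /minw : x \in C `&` [set x | dot x x <= dot a0 a0].
  by rewrite inE; split => //=; exact: le_trans (ltW xw) wa0.
by rewrite leNgt xw.
Qed.

Lemma closedI_hyperplane_compact (R : realType) (n : nat) (A : set 'rV[R]_n)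
    (v : 'rV[R]_n) :
  compact A -> compact (A `&` [set x | dot x v = 0]).
Proof.
move=> cA; apply: compact_closedI => //.
rewrite (_ : mkset _ = (fun x => dot x v) @^-1` [set 0])//.
by apply: preimage_closed => [x _|]; [exact: dotl_continuous|exact: closed_eq].
Qed.

Definition perp (R : realType) (n : nat) (A B : set 'rV[R]_n) : set 'rV[R]_n :=
  [set a | A a /\ forall b, B b -> dot a b = 0].

(** Only the points of A orthogonal to B constrain A to lie outside an open half
    space: elsewhere some -x.b is positive, and subtracting large multiples of
    finitely many such b from w makes the form positive on all of A. *)
Lemma perp_half_space (R : realType) (n : nat) (A B : set 'rV[R]_n)
    (w : 'rV[R]_n) :
  compact A -> (forall a b, A a -> B b -> dot a b <= 0) ->
  (forall a, perp A B a -> 0 < dot a w) ->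
  exists y : 'rV[R]_n, forall a, A a -> 0 < dot a y.
Proof.
move=> cA AB pw.
have [B0|/set0P B0] := eqVneq B set0.
  by exists w => a Aa; apply: pw; split => // b; rewrite B0.
have [||||D DB Dw] := @compact_penalty R 'rV[R]_n A 'rV[R]_n B
  (fun x => dot x w) (fun b x => dot x (- b)) B0 cA.
- exact: dotl_continuous.
- by move=> b _; exact: dotl_continuous.
- by move=> b x Bb Ax; rewrite dotNr oppr_ge0 AB.
- move=> x Ax x0; apply: pw; split => // b Bb.
  by apply/eqP; rewrite -oppr_eq0 -dotNr x0.
exists (w - \sum_(d <- D) d.2%:R *: d.1) => a Aa.
rewrite dotC dotBl dot_suml -sumrN dotC.
rewrite (eq_bigr (fun d => d.2%:R * dot a (- d.1))); first exact: Dw.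
by move=> d _; rewrite dotZl dotNr mulrN dotC.
Qed.

(** * Graphs over a great sphere *)

(** A linear parametrization M of the hyperplane orthogonal to w, with left
    inverse N. It need not be isometric, since directions are normalized
    afterwards. *)
Lemma hyperplane_chart (R : realType) (n : nat) (w : 'rV[R]_n.+1) :
  w != 0 ->
  exists (M : 'M[R]_(n, n.+1)) (N : 'M[R]_(n.+1, n)),
    [/\ M *m N = 1%:M, forall y, dot (y *m M) w = 0 &
        forall x : 'rV[R]_n.+1, dot x w = 0 -> x *m N *m M = x].
Proof.
move=> w0.
have rK : \rank (kermx w^T) = n.
  by rewrite mxrank_ker mxrank_tr rank_rV w0 subn1.
have [M [Mf MK]] : exists M : 'M[R]_(n, n.+1),
    row_free M /\ (M :=: kermx w^T)%MS.
  move: (row_base_free (kermx w^T)) (eq_row_base (kermx w^T)).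
  by move: (row_base _); rewrite rK => M; exists M.
exists M, (pinvmx M); split => [|y|x xw].
- exact: mulmxVp.
- have /sub_kermxP : (y *m M <= kermx w^T)%MS by rewrite -MK submxMl.
  by rewrite dotE => ->; rewrite mxE.
- apply: mulmxKpV; rewrite MK; apply/sub_kermxP.
  by apply/rowP => i; rewrite ord1 -dotE xw mxE.
Qed.

(** The equation x.w = H(x) describes the graph of H over the hyperplane
    orthogonal to w. Homogeneity makes this graph a cone, so that its trace on
    the unit sphere meets every half great circle from -w to w once. *)
Definition cone_graph (R : realType) (n : nat) (w : 'rV[R]_n)
    (H : 'rV[R]_n -> R) : Prop :=
  [/\ dot w w = 1, continuous H, forall t x, 0 <= t -> H (t *: x) = t * H x &
      forall t x, H (x + t *: w) = H x].

Lemma cone_graph0 (R : realType) (n : nat) (w : 'rV[R]_n)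
    (H : 'rV[R]_n -> R) : cone_graph w H -> H 0 = 0.
Proof. by case=> _ _ HZ _; rewrite -(scale0r 0) HZ// mul0r. Qed.

(** Points of the unit sphere of R^(n+1) are lifted to the graph and projected
    radially to the sphere; dropping the w-component and normalizing inverts
    this. *)
Lemma graph_sphere (R : realType) (n : nat) (w : 'rV[R]_n.+2)
    (H : 'rV[R]_n.+2 -> R) :
  cone_graph w H ->
  @embedded_sphere R n n.+1 (usphere R n.+1 `&` [set x | dot x w = H x]).
Proof.
move=> cgH; have H0 := cone_graph0 cgH; case: cgH => w1 cH HZ HD.
split; first by move=> x [].
have [M [N [MN Mw NM]]] := hyperplane_chart (usphere_neq0 w1).
pose e (y : 'rV[R]_n.+1) := y *m M + H (y *m M) *: w.
pose p (x : 'rV[R]_n.+2) := (x - dot x w *: w) *m N.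
have pZ k x : p (k *: x) = k *: p x.
  by rewrite /p dotZl -scalerA -scalerBr -scalemxAl.
have pe y : p (e y) = y.
  by rewrite /p /e dotDl Mw dotZl w1 mulr1 add0r addrK -mulmxA MN mulmx1.
have e0 y : y != 0 -> e y != 0.
  by apply: contraNneq => ey; rewrite -[y]pe ey /p dot0l scale0r subr0 mul0mx.
have ep x : dot x w = H x -> e (p x) = x.
  move=> xH; rewrite /e /p NM; last by rewrite dotBl dotZl w1 mulr1 subrr.
  by rewrite -scaleNr HD -xH scaleNr subrK.
have HU x : H (unitize x) = (Num.sqrt (dot x x))^-1 * H x.
  by rewrite HZ// invr_ge0 sqrtr_ge0.
have inv0 (m : nat) (x : 'rV[R]_m) : x != 0 -> 0 < (Num.sqrt (dot x x))^-1.
  by move=> x0; rewrite invr_gt0 sqrt_dot_gt0.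
pose f y := unitize (e y).
have fK y : usphere R n y -> unitize (p (f y)) = y.
  move=> y1; rewrite {1}/f {2}/unitize pZ pe unitizeZ ?unitize_id//.
  exact/inv0/e0/usphere_neq0.
have p0 x : usphere R n.+1 x -> dot x w = H x -> p x != 0.
  move=> x1 xH; apply: contraTneq (usphere_neq0 x1) => px.
  by rewrite -(ep x xH) px /e mul0mx H0 scale0r addr0 eqxx.
have fS y : usphere R n y ->
    usphere R n.+1 (f y) /\ dot (f y) w = H (f y).
  move=> y1; have ey0 := e0 _ (usphere_neq0 y1).
  split; first exact: dot_unitize.
  rewrite HU dotZl; congr (_ * _).
  by rewrite /e HD dotDl Mw add0r dotZl w1 mulr1.
have ce : continuous e.
  move=> y.
  have cM : (fun y : 'rV_n.+1 => y *m M) @ y --> y *m M.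
    exact: mulmxr_continuous.
  have cHM : (fun y : 'rV_n.+1 => H (y *m M)) @ y --> H (y *m M).
    exact: (cvg_comp _ _ cM (cH _)).
  exact: (cvgD cM (cvgZ cHM (cvg_cst w))).
have cp : continuous p.
  move=> x.
  have cx : (fun x => x - dot x w *: w) @ x --> x - dot x w *: w.
    have cd : (fun x => dot x w) @ x --> dot x w by exact: dotl_continuous.
    exact: (cvgB cvg_id (cvgZ cd (cvg_cst w))).
  exact: (cvg_comp _ _ cx (@mulmxr_continuous R _ _ N _)).
exists f; split; last first.
  apply/seteqP; split => [_ [y y1 <-]|x [x1 xH]]; first exact: fS.
  have px0 := p0 x x1 xH.
  exists (unitize (p x)); first exact: dot_unitize.
  have [k k0 ->] : exists2 k, 0 < k & unitize (p x) = k *: p x.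
    by eexists; first exact: (inv0 _ _ px0).
  rewrite /f /e -scalemxAl HZ ?ltW// -scalerA -scalerDr unitizeZ//.
  by rewrite -/(e (p x)) ep// unitize_id.
split.
  apply: continuous_in_subspaceT => y /[!inE] y1.
  exact: (unitize_cvg (e0 _ (usphere_neq0 y1)) (ce y)).
exists (fun x => unitize (p x)); split; first exact: fK.
apply: continuous_in_subspaceT => _ /[!inE] -[y y1 <-].
have [fy1 fyH] := fS y y1.
exact: (unitize_cvg (p0 _ fy1 fyH) (cp _)).
Qed.

(** The segment from a point above the cone to w stays above the cone, hence
    avoids the origin, and can be pushed radially to the sphere. *)
Lemma upper_side_connected (R : realType) (n : nat) (w : 'rV[R]_n.+1)
    (H : 'rV[R]_n.+1 -> R) :
  cone_graph w H -> connected (usphere R n `&` [set x | H x < dot x w]).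
Proof.
move=> cgH; have H0 := cone_graph0 cgH; case: cgH => w1 _ HZ HD.
set U := _ `&` _.
pose seg x (t : R) := (1 - t) *: x + t *: w.
have segH x t : U x -> `[0, 1]%classic t -> H (seg x t) < dot (seg x t) w.
  move=> [_ /= xH]; rewrite /= in_itv/= => /andP[t0 t1].
  rewrite HD dotDl !dotZl w1 mulr1 HZ ?subr_ge0//.
  have : 0 <= (1 - t) * (dot x w - H x) by rewrite mulr_ge0 ?subr_ge0// ltW.
  by move: t0; rewrite le_eqVlt => /predU1P[<-|?] ?; lra.
have seg0 x t : U x -> `[0, 1]%classic t -> seg x t != 0.
  move=> Ux t01; apply: contraTneq (segH x t Ux t01) => ->.
  by rewrite H0 dot0l ltxx.
have segU x t : U x -> `[0, 1]%classic t -> U (unitize (seg x t)).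
  move=> Ux t01; have s0 := seg0 _ _ Ux t01; split; first exact: dot_unitize.
  rewrite /= HZ ?invr_ge0 ?sqrtr_ge0// dotZl ltr_pM2l ?segH//.
  by rewrite invr_gt0 sqrt_dot_gt0.
have -> : U = \bigcup_(x in U) ((fun t => unitize (seg x t)) @` `[0, 1]%classic).
  apply/seteqP; split => [x Ux|x [y Uy [t t01 <-]]]; last exact: segU.
  exists x => //; exists 0; first by rewrite /= in_itv/= lexx ler01.
  by rewrite /seg subr0 scale1r scale0r addr0 unitize_id//; case: Ux.
apply: bigcup_connected.
  exists w => x Ux; exists 1; first by rewrite /= in_itv/= lexx ler01.
  by rewrite /seg subrr scale0r scale1r add0r unitize_id.
move=> x Ux; apply: connected_continuous_connected; first exact: segment_connected.
apply: continuous_in_subspaceT => t /[!inE] t01.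
apply: unitize_cvg; first exact: seg0.
apply: cvgD; apply: cvgZr_tmp; last exact: cvg_id.
by apply: cvgB; [exact: cvg_cst|exact: cvg_id].
Qed.

(** The two sides of the graph lie in different components because x.w - H(x)
    does not vanish off the graph and is 1 at w and -1 at -w. *)
Lemma unlinked_graph (R : realType) (n : nat) (A B : set 'rV[R]_n.+2)
    (w : 'rV[R]_n.+2) (H : 'rV[R]_n.+2 -> R) :
  cone_graph w H -> A `<=` usphere R n.+1 -> B `<=` usphere R n.+1 ->
  (forall a, A a -> H a < dot a w) -> (forall b, B b -> dot b w < H b) ->
  @unlinked R n.+1 A B.
Proof.
move=> cgH sA sB AH BH; have H0 := cone_graph0 cgH.
exists (usphere R n.+1 `&` [set x | dot x w = H x]); split.
  exact: graph_sphere.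
set X := _ `\` _.
have cgN : cone_graph (- w) (fun x => - H x).
  case: cgH => w1 cH HZ HD; split => [||t x t0|t x].
  - by rewrite dotNl dotNr opprK.
  - by move=> x; exact: (cvgN (cH x)).
  - by rewrite HZ// mulrN.
  - by rewrite scalerN -scaleNr HD.
case: (cgH) => w1 cH _ HD.
have Hw : H w = 0 by rewrite -[w]scale1r -[_ *: w]add0r HD.
have HNw : H (- w) = 0 by rewrite -scaleN1r -[_ *: w]add0r HD.
have XP x : X x -> dot x w - H x <> 0.
  by move=> [x1 xS] /eqP; rewrite subr_eq0 => /eqP xH; apply: xS.
have Xw : X w by split => // -[_ /=]; rewrite w1 Hw => /eqP; rewrite oner_eq0.
have XNw : X (- w).
  split; first by rewrite /usphere /= dotNl dotNr opprK.
  by move=> [_ /=]; rewrite dotNl w1 HNw => /eqP; rewrite oppr_eq0 oner_eq0.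
exists (connected_component X w), (connected_component X (- w)); split.
- by exists w.
- by exists (- w).
- move=> CD.
  have : connected ((fun x => dot x w - H x) @` connected_component X w).
    apply: connected_continuous_connected; first exact: component_connected.
    apply: continuous_subspaceT => x.
    exact: (cvgB (@dotl_continuous _ _ w x) (cH x)).
  move=> /connected_intervalP itvC.
  have [|||x /connected_component_sub /XP//] := itvC (-1) 1 _ _ 0.
  - exists (- w); last by rewrite dotNl w1 HNw subr0.
    by rewrite CD; exact: connected_component_refl.
  - exists w; last by rewrite w1 Hw subr0.
    exact: connected_component_refl.
  - by rewrite lerN10 ler01.
- move=> a Aa.
  apply: (@connected_component_max _ X (usphere R n.+1 `&` [set x | H x < dot x w])).
  + by split => //=; rewrite Hw w1 ltr01.
  + by move=> x [x1 /= xH]; split => // -[_ /= xe]; move: xH; rewrite xe ltxx.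
  + exact: upper_side_connected.
  + by split; [exact: sA|exact: AH].
- move=> b Bb.
  apply: (@connected_component_max _ X
    (usphere R n.+1 `&` [set x | - H x < dot x (- w)])).
  + split; first by case: XNw.
    by rewrite /= HNw dotNl dotNr opprK w1 oppr0 ltr01.
  + move=> x [x1 /=]; rewrite dotNr ltrN2 => xH; split => // -[_ /= xe].
    by move: xH; rewrite xe ltxx.
  + exact: (upper_side_connected cgN).
  + by split; [exact: sB|rewrite /= dotNr ltrN2; exact: BH].
Qed.

Lemma unlinked_sym (R : realType) (n : nat) (A B : set 'rV[R]_n.+1) :
  unlinked A B -> unlinked B A.
Proof.
move=> [S [eS [C [D [cC cD CD AC BD]]]]]; exists S; split => //.
by exists D, C; split => // /esym.
Qed.

(** * Jordan curves in a circle *)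

Lemma within_continuous_comp (R : realType) (T U : topologicalType)
    (K : set T) (f : T -> U) (c : R -> T) :
  {within K, continuous f} -> continuous c -> (forall t, K (c t)) ->
  continuous (f \o c).
Proof.
move=> cf cc cK t.
have ct : c @ t --> within K (nbhs (c t)).
  move=> P /= /(cc t) cP; change (nbhs t (c @^-1` P)).
  apply: (@filterS _ _ _ (c @^-1` [set x | K x -> P x]) _ _ cP) => s /=.
  by apply; exact: cK.
have h : f @ within K (nbhs (c t)) --> f (c t).
  by rewrite (nbhs_subspace_in (cK t)); exact: (cf (c t)).
exact: (cvg_comp _ _ ct h).
Qed.

Definition circle_point (R : realType) (t : R) : 'rV[R]_2 :=
  \row_j (if j == 0 then cos t else sin t).

Lemma circle_point_usphere (R : realType) (t : R) :
  usphere R 1 (circle_point t).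
Proof.
by rewrite /usphere /= /dot !big_ord_recl big_ord0 !mxE/= addr0 -!expr2 cos2Dsin2.
Qed.

Lemma circle_point_continuous (R : realType) : continuous (@circle_point R).
Proof.
move=> t; apply: (@cvg_mx_coord _ _ _ _ (nbhs t)) => i j.
rewrite mxE; under eq_fun do rewrite mxE.
by case: (j == 0); [exact: continuous_cos|exact: continuous_sin].
Qed.

Lemma usphereN (R : realType) (n : nat) (x : 'rV[R]_n.+1) :
  usphere R n x -> usphere R n (- x).
Proof. by rewrite /usphere /= dotNl dotNr opprK. Qed.

(** The odd function f(c(t)) - f(-c(t)) takes opposite values at t = 0 and
    t = pi. *)
Lemma borsuk_ulam_circle (R : realType) (f : 'rV[R]_2 -> R) :
  {within usphere R 1, continuous f} ->
  exists2 x, usphere R 1 x & f x = f (- x).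
Proof.
move=> cf.
pose c := @circle_point R; pose phi t := f (c t) - f (- c t).
have cphi : continuous phi.
  have c1 := within_continuous_comp cf (@circle_point_continuous R)
    (@circle_point_usphere R).
  have cN : continuous (fun t => - c t).
    by move=> t; exact: (cvgN (@circle_point_continuous R t)).
  have c2 := within_continuous_comp cf cN
    (fun t => usphereN (circle_point_usphere t)).
  by move=> t; exact: (cvgB (c1 t) (c2 t)).
have cpi : c pi = - c 0.
  apply/rowP => j; rewrite !mxE cospi sinpi cos0 sin0.
  by case: (j == 0); rewrite ?oppr0.
have phipi : phi pi = - phi 0 by rewrite /phi cpi opprK opprB.
have [||t _ phit] := @IVT R phi 0 pi 0 (pi_ge0 R).
- exact: continuous_subspaceT.
- rewrite phipi ge_min le_max; have [p0|p0] := leP (phi 0) 0.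
    by rewrite oppr_ge0 p0 orbT.
  by rewrite oppr_le0 (ltW p0) orbT.
exists (c t); first exact: circle_point_usphere.
by apply/eqP; rewrite -subr_eq0 -[X in X == _]/(phi t) phit.
Qed.

(** Here p is the centre of projection, and (c.p, c x p) are the coordinates of
    c in the frame given by p and its rotation by a right angle. *)
Lemma stereographic_inj (R : realType) (p0 p1 c0 c1 d0 d1 : R) :
  p0 ^+ 2 + p1 ^+ 2 = 1 -> c0 ^+ 2 + c1 ^+ 2 = 1 -> d0 ^+ 2 + d1 ^+ 2 = 1 ->
  c0 * p0 + c1 * p1 != 1 -> d0 * p0 + d1 * p1 != 1 ->
  (c0 * p1 - c1 * p0) / (1 - (c0 * p0 + c1 * p1)) =
  (d0 * p1 - d1 * p0) / (1 - (d0 * p0 + d1 * p1)) ->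
  c0 = d0 /\ c1 = d1.
Proof.
set al := c0 * p0 + _; set be := c0 * p1 - _.
set ga := d0 * p0 + _; set de := d0 * p1 - _.
move=> p1E c1E d1E al1 ga1.
have al0 : 1 - al != 0 by rewrite subr_eq0 eq_sym.
have ga0 : 1 - ga != 0 by rewrite subr_eq0 eq_sym.
move=> /eqP; rewrite eqr_div// => /eqP E.
have abE : be ^+ 2 = (1 - al) * (1 + al).
  have : al ^+ 2 + be ^+ 2 = (c0 ^+ 2 + c1 ^+ 2) * (p0 ^+ 2 + p1 ^+ 2).
    by rewrite /al /be; ring.
  by rewrite c1E p1E => h; lra.
have gdE : de ^+ 2 = (1 - ga) * (1 + ga).
  have : ga ^+ 2 + de ^+ 2 = (d0 ^+ 2 + d1 ^+ 2) * (p0 ^+ 2 + p1 ^+ 2).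
    by rewrite /ga /de; ring.
  by rewrite d1E p1E => h; lra.
have agE : al = ga.
  have E2 : (be * (1 - ga)) ^+ 2 = (de * (1 - al)) ^+ 2 by rewrite E.
  have : (1 - al) * ((1 - ga) * (2 * (al - ga))) = 0.
    transitivity ((be * (1 - ga)) ^+ 2 - (de * (1 - al)) ^+ 2).
      by rewrite !exprMn abE gdE; ring.
    by rewrite E2 subrr.
  move/eqP; rewrite !mulf_eq0 (negbTE al0) (negbTE ga0) pnatr_eq0/= subr_eq0.
  by move/eqP.
have bdE : be = de by apply: (mulIf ga0); rewrite E agE.
have cE0 : c0 = al * p0 + be * p1.
  transitivity (c0 * (p0 ^+ 2 + p1 ^+ 2)); first by rewrite p1E mulr1.
  by rewrite /al /be; ring.
have cE1 : c1 = al * p1 - be * p0.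
  transitivity (c1 * (p0 ^+ 2 + p1 ^+ 2)); first by rewrite p1E mulr1.
  by rewrite /al /be; ring.
have dE0 : d0 = ga * p0 + de * p1.
  transitivity (d0 * (p0 ^+ 2 + p1 ^+ 2)); first by rewrite p1E mulr1.
  by rewrite /ga /de; ring.
have dE1 : d1 = ga * p1 - de * p0.
  transitivity (d1 * (p0 ^+ 2 + p1 ^+ 2)); first by rewrite p1E mulr1.
  by rewrite /ga /de; ring.
by rewrite cE0 cE1 agE bdE -dE0 -dE1.
Qed.

(** The rows of U are an orthonormal frame of the plane in which A lies, so that
    x U^T gives plane coordinates. If x were missing from A, the stereographic
    projection from x would be injective and continuous on the curve, whereas
    Borsuk-Ulam yields two antipodal parameters with the same image. *)
Lemma jordan_curve_circle (R : realType) (n : nat) (A : set 'rV[R]_n.+1)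
    (U : 'M[R]_(2, n.+1)) :
  jordan_curve A -> U *m U^T = 1%:M ->
  (forall a, A a -> a *m U^T *m U = a) ->
  forall x, usphere R n x -> x *m U^T *m U = x -> A x.
Proof.
move=> [sA [f [[cf [g [gK _]]] fA]]] UU AU x x1 xU.
apply: contrapT => nAx.
have dotU (z : 'rV[R]_n.+1) : z *m U^T *m U = z ->
    (z *m U^T) 0 0 ^+ 2 + (z *m U^T) 0 1 ^+ 2 = dot z z.
  move=> zU; have -> : dot z z = dot (z *m U^T) (z *m U^T).
    by rewrite !dotE trmx_mul trmxK mulmxA zU.
  rewrite /dot !big_ord_recl big_ord0 addr0 -!expr2.
  by rewrite [lift ord0 ord0](_ : _ = 1)//; exact: val_inj.
have fAy y : usphere R 1 y -> A (f y) by move=> y1; rewrite -fA; exists y.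
pose p := x *m U^T; pose c y := f y *m U^T.
pose al y := c y 0 0 * p 0 0 + c y 0 1 * p 0 1.
pose be y := c y 0 0 * p 0 1 - c y 0 1 * p 0 0.
have p1 : p 0 0 ^+ 2 + p 0 1 ^+ 2 = 1 by rewrite dotU.
have c1 y : usphere R 1 y -> c y 0 0 ^+ 2 + c y 0 1 ^+ 2 = 1.
  by move=> y1; rewrite dotU; [exact: sA (fAy y y1)|exact/AU/fAy].
have c_inj (y z : 'rV[R]_n.+1) : y *m U^T *m U = y -> z *m U^T *m U = z ->
    (y *m U^T) 0 0 = (z *m U^T) 0 0 -> (y *m U^T) 0 1 = (z *m U^T) 0 1 -> y = z.
  move=> yU zU e0 e1; rewrite -yU -zU; congr (_ *m _).
  apply/rowP => i; case: i => -[|[|//]] i2.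
    by rewrite (_ : Ordinal i2 = 0)//; exact: val_inj.
  by rewrite (_ : Ordinal i2 = 1)//; exact: val_inj.
have al1 y : usphere R 1 y -> al y != 1.
  move=> y1; apply/negP => /eqP aly; apply: nAx.
  suff <- : f y = x by exact: fAy.
  have cy1 := c1 y y1.
  have [e0 e1] : c y 0 0 = p 0 0 /\ c y 0 1 = p 0 1.
    have : (c y 0 0 - p 0 0) ^+ 2 + (c y 0 1 - p 0 1) ^+ 2 = 0.
      by move: aly cy1 p1; rewrite /al => ? ? ?; nra.
    move/eqP; rewrite paddr_eq0 ?sqr_ge0// !sqrf_eq0 !subr_eq0.
    by move=> /andP[/eqP -> /eqP ->].
  by apply: c_inj => //; exact/AU/fAy.
have [|y y1 sy] := @borsuk_ulam_circle R (fun y => be y / (1 - al y)).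
  rewrite continuous_subspace_in => y /[!inE] y1.
  have cc j : (fun y => c y 0 j) @ (y : subspace (usphere R 1)) --> c y 0 j.
    have := cvg_comp _ _ (cf y) (@mulmxr_continuous _ _ _ U^T (f y)).
    move=> h; exact: (cvg_comp _ _ h (@coord_continuous _ _ _ 0 j _)).
  apply: cvgM.
    by apply: cvgB; apply: cvgM; [exact: cc|exact: cvg_cst|exact: cc|exact: cvg_cst].
  apply: cvgV; first by rewrite subr_eq0 eq_sym al1.
  apply: cvgB; first exact: cvg_cst.
  by apply: cvgD; apply: cvgM; [exact: cc|exact: cvg_cst|exact: cc|exact: cvg_cst].
have y1' := usphereN y1.
have [e0 e1] := stereographic_inj p1 (c1 _ y1) (c1 _ y1') (al1 _ y1) (al1 _ y1') sy.
have fy : f y = f (- y) by apply: c_inj => //; exact/AU/fAy.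
have yN : y = - y by rewrite -{1}(gK _ y1) fy gK.
have := usphere_neq0 y1; have /eqP : y + y = 0 by rewrite {2}yN subrr.
by rewrite -mulr2n -scaler_nat scaler_eq0 pnatr_eq0/= => ->.
Qed.

(** * Orthonormal frames and dual great circles *)

Lemma exists_unit_perp (R : realType) (k n : nat) (M : 'M[R]_(k, n.+1)) :
  (k <= n)%N -> exists2 x, usphere R n x & x *m M^T = 0.
Proof.
move=> kn; have : kermx M^T != 0.
  rewrite -mxrank_eq0 mxrank_ker mxrank_tr -lt0n subn_gt0.
  exact: leq_ltn_trans (rank_leq_row M) _.
move=> /rowV0Pn [v /sub_kermxP vM v0].
by exists (unitize v); [exact: dot_unitize|rewrite -scalemxAl vM scaler0].
Qed.

Lemma mulmx_tr_col (R : realType) (m1 m2 n : nat) (x : 'rV[R]_n)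
    (M1 : 'M[R]_(m1, n)) (M2 : 'M[R]_(m2, n)) :
  x *m (col_mx M1 M2)^T = 0 <-> x *m M1^T = 0 /\ x *m M2^T = 0.
Proof.
rewrite tr_col_mx mul_mx_row; split; last by case=> -> ->; rewrite row_mx0.
by move=> h; apply: eq_row_mx; rewrite h row_mx0.
Qed.

Lemma mulmx_tr_dot (R : realType) (n : nat) (x y : 'rV[R]_n) :
  x *m y^T = (dot x y)%:M.
Proof. by rewrite dotE -mx11_scalar. Qed.

Lemma mulmx_tr_eq0 (R : realType) (n : nat) (x y : 'rV[R]_n) :
  x *m y^T = 0 <-> dot x y = 0.
Proof.
rewrite mulmx_tr_dot; split => [/matrixP/(_ 0 0)|->]; last by rewrite raddf0.
by rewrite !mxE eqxx mulr1n.
Qed.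

Lemma mulmx_tr_pair (R : realType) (n : nat) (x u v : 'rV[R]_n) :
  x *m (col_mx u v : 'M[R]_(2, n))^T = 0 <-> dot x u = 0 /\ dot x v = 0.
Proof.
apply: (iff_trans (@mulmx_tr_col R 1 1 n x u v)).
by split=> -[/mulmx_tr_eq0 xu /mulmx_tr_eq0 xv].
Qed.

Lemma col_mx_orthonormal (R : realType) (n : nat) (u v : 'rV[R]_n) :
  dot u u = 1 -> dot v v = 1 -> dot u v = 0 ->
  col_mx u v *m (col_mx u v)^T = 1%:M :> 'M[R]_2.
Proof.
move=> u1 v1 uv; rewrite tr_col_mx mul_col_row !mulmx_tr_dot (dotC v) u1 v1 uv.
by rewrite raddf0 -scalar_mx_block.
Qed.

Definition dual_frames (R : realType) (U V : 'M[R]_(2, 4)) : Prop :=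
  [/\ U *m U^T = 1%:M, V *m V^T = 1%:M & U *m V^T = 0].

Lemma dual_frames_sym (R : realType) (U V : 'M[R]_(2, 4)) :
  dual_frames U V -> dual_frames V U.
Proof.
move=> [UU VV UV]; split => //.
by rewrite -(trmxK V) -trmx_mul UV trmx0.
Qed.

Lemma dual_frames_resolution (R : realType) (U V : 'M[R]_(2, 4)) :
  dual_frames U V -> U^T *m U + V^T *m V = 1%:M.
Proof.
move=> /[dup] /dual_frames_sym [_ _ VU] [UU VV UV].
have : col_mx U V *m (col_mx U V)^T = 1%:M :> 'M[R]_(2 + 2).
  by rewrite tr_col_mx mul_col_row UU VV UV VU -scalar_mx_block.
by move/mulmx1C; rewrite tr_col_mx mul_row_col.
Qed.

Lemma dual_frames_proj (R : realType) (U V : 'M[R]_(2, 4)) (x : 'rV[R]_4) :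
  dual_frames U V -> x *m V^T = 0 -> x *m U^T *m U = x.
Proof.
move=> /dual_frames_resolution UV xV.
by rewrite -[RHS]mulmx1 -UV mulmxDr !mulmxA xV mul0mx addr0.
Qed.

(** The two planes are given by orthonormal frames rather than by subspaces, so
    that exchanging A and B exchanges U and V. *)
Definition dual_circles (R : realType) (A B : set 'rV[R]_4) : Prop :=
  exists U V : 'M[R]_(2, 4), [/\ dual_frames U V,
    A = usphere R 3 `&` [set x | x *m V^T = 0] &
    B = usphere R 3 `&` [set x | x *m U^T = 0]].

Lemma dual_circles_sym (R : realType) (A B : set 'rV[R]_4) :
  dual_circles A B -> dual_circles B A.
Proof.
by move=> [U [V [/dual_frames_sym UV AE BE]]]; exists V, U.
Qed.

Lemma dual_circles_vspace (R : realType) (A B : set 'rV[R]_4) :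
  dual_circles A B -> exists P : {vspace 'rV[R]_4},
    [/\ (\dim P = 2)%N, A = usphere R 3 `&` [set x | x \in P] &
        B = usphere R 3 `&` orthocomp P].
Proof.
move=> [U [V [UV -> ->]]]; have [UU VV UV0] := UV.
pose h : 'Hom('rV[R]_4, 'rV[R]_2) := linfun (mulmxr V^T).
have hE x : h x = x *m V^T by rewrite lfunE.
have kerE x : (x \in lker h) = (x *m V^T == 0) by rewrite memv_ker hE.
exists (lker h); split.
- have := limg_ker_dim h fullv; rewrite capfv dimvf.
  have -> : limg h = fullv.
    apply/eqP; rewrite eqEsubv subvf/=; apply/subvP => y _.
    by apply/memv_imgP; exists (y *m V); rewrite ?memvf// hE -mulmxA VV mulmx1.
  rewrite dimvf /dim/= !mul1n => e.
  by apply/eqP; rewrite -(eqn_add2r 2) e.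
- by apply/seteqP; split => x [x1 /=]; rewrite ?kerE => /eqP xV; split => //=;
    rewrite ?kerE; exact/eqP.
- apply/seteqP; split => x [x1 xU]; split => //.
    move=> y; rewrite kerE => /eqP yV.
    rewrite dotC -(dual_frames_proj UV yV) dotE trmx_mul mulmxA.
    by rewrite /= in xU; rewrite xU mul0mx mxE.
  apply/rowP => i; have := xU (row i U).
  rewrite kerE -row_mul UV0 row0 eqxx => /(_ isT) xUi.
  rewrite mxE [RHS]mxE -[RHS]xUi dotC.
  by apply: eq_bigr => j _; rewrite !mxE.
Qed.

(** * Jordan curves with nonpositive dot products *)

Lemma jordan_curve_compact (R : realType) (n : nat) (A : set 'rV[R]_n.+1) :
  jordan_curve A -> compact A.
Proof.
move=> [_ [f [[cf _] <-]]]; apply: continuous_compact => //.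
exact: usphere_compact.
Qed.

Lemma jordan_curve_neq0 (R : realType) (n : nat) (A : set 'rV[R]_n.+1) :
  jordan_curve A -> A !=set0.
Proof.
move=> [_ [f [_ <-]]]; exists (f (circle_point 0)).
by exists (circle_point 0) => //; exact: circle_point_usphere.
Qed.

(** The vectors b and c, orthogonal to A, span a plane because c is not b or -b.
    So A fills the great circle orthogonal to it, and then x.y <= 0 for
    both x and -x in A forces y in B into the plane of b and c. *)
Lemma dual_circles_of_perp (R : realType) (A B : set 'rV[R]_4)
    (a b c : 'rV[R]_4) :
  jordan_curve A -> jordan_curve B ->
  (forall x y, A x -> B y -> dot x y <= 0) ->
  perp A B a -> perp B A b -> perp B A c -> c <> b -> c <> - b ->
  dual_circles A B.
Proof.
move=> jA jB AB [Aa aB] [Bb bA] [Bc cA] cb cNb.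
have sA := jA.1; have sB := jB.1.
have [a1 b1 c1] : [/\ dot a a = 1, dot b b = 1 & dot c c = 1].
  by split; [exact: sA|exact: sB|exact: sB].
pose d := c - dot c b *: b.
have d0 : d != 0.
  rewrite subr_eq0; apply/negP => /eqP ce.
  have : dot c b ^+ 2 = 1 by rewrite -[RHS]c1 {2 3}ce dotZl dotZr b1; ring.
  move=> /eqP; rewrite sqrf_eq1 => /orP[] /eqP k1; move: ce; rewrite k1.
    by rewrite scale1r.
  by rewrite scaleN1r.
have db : dot d b = 0 by rewrite dotBl dotZl b1 mulr1 subrr.
have dA x : A x -> dot d x = 0.
  by move=> Ax; rewrite dotBl dotZl (cA _ Ax) (bA _ Ax) mulr0 subrr.
pose e := unitize d.
have e1 : dot e e = 1 by exact: dot_unitize.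
have be : dot b e = 0 by rewrite dotZr (dotC b) db mulr0.
have eA x : A x -> dot x e = 0 by move=> Ax; rewrite dotZr (dotC x) (dA x)// mulr0.
(* e completes b to an orthonormal frame of the plane of b and c, and f
   completes a to one of the orthogonal plane. *)
have [f f1 /mulmx_tr_col[/mulmx_tr_eq0 fa]] :=
  @exists_unit_perp R (1 + (1 + 1)) 3 (col_mx a (col_mx b e)) isT.
move=> /mulmx_tr_col[/mulmx_tr_eq0 fb /mulmx_tr_eq0 fe].
pose U : 'M[R]_(2, 4) := col_mx a f; pose V : 'M[R]_(2, 4) := col_mx b e.
have VP (x : 'rV_4) : x *m V^T = 0 <-> dot x b = 0 /\ dot x e = 0.
  exact: mulmx_tr_pair.
have UP (x : 'rV_4) : x *m U^T = 0 <-> dot x a = 0 /\ dot x f = 0.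
  exact: mulmx_tr_pair.
have UV : dual_frames U V.
  split; [by apply: col_mx_orthonormal => //; rewrite dotC| |].
    exact: col_mx_orthonormal.
  have aV : a *m V^T = 0 by apply/VP; rewrite aB// eA.
  have fV : f *m V^T = 0 by apply/VP.
  apply: (etrans (@mul_col_mx R 1 1 4 2 a f V^T)).
  by rewrite aV fV col_mx0.
have AE : A = usphere R 3 `&` [set x | x *m V^T = 0].
  have AV x : A x -> x *m V^T = 0 by move=> Ax; apply/VP; rewrite eA// dotC bA.
  apply/seteqP; split => [x Ax|x [x1 /= xV]]; first by split; [exact: sA|exact: AV].
  apply: (@jordan_curve_circle _ _ _ U) => //; first by case: UV.
    by move=> y Ay; apply: (dual_frames_proj UV); exact: AV.
  exact: (dual_frames_proj UV).
have Af : A f by rewrite AE; split => //; exact/VP.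
have ANf : A (- f).
  rewrite AE; split; first exact: usphereN.
  by apply/VP; rewrite !dotNl fb fe oppr0.
have BU y : B y -> y *m U^T = 0.
  move=> By; apply/UP; split; first by rewrite dotC aB.
  apply/eqP; rewrite eq_le dotC AB//=.
  by have := AB _ _ ANf By; rewrite dotNl oppr_le0.
exists U, V; split => //.
apply/seteqP; split => [y By|y [y1 /= yU]]; first by split; [exact: sB|exact: BU].
have VU := dual_frames_sym UV.
apply: (@jordan_curve_circle _ _ _ V) => //; first by case: VU.
  by move=> z Bz; apply: (dual_frames_proj VU); exact: BU.
exact: (dual_frames_proj VU).
Qed.

(** The form x.w is positive on A but may vanish on B, so the great sphere
    orthogonal to w is replaced by the trace of the cone x.w = eps |x'|, where
    x' is the component of x orthogonal to w. *)
Lemma half_space_unlinked (R : realType) (n : nat) (A B : set 'rV[R]_n.+2)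
    (y : 'rV[R]_n.+2) :
  compact A -> A !=set0 -> A `<=` usphere R n.+1 -> B `<=` usphere R n.+1 ->
  (forall a b, A a -> B b -> dot a b <= 0) ->
  (forall a, A a -> 0 < dot a y) ->
  @unlinked R n.+1 A B.
Proof.
move=> cA [a0 Aa0] sA sB AB Ay.
have [v [Av Bv]] := polar_functional cA Ay AB.
have v0 : v != 0.
  by apply: contraTneq (Av _ Aa0) => ->; rewrite dotC dot0l ltxx.
have k0 : 0 < (Num.sqrt (dot v v))^-1 by rewrite invr_gt0 sqrt_dot_gt0.
pose w := unitize v.
have w1 : dot w w = 1 by exact: dot_unitize.
have Aw a : A a -> 0 < dot a w by move=> Aa; rewrite dotZr mulr_gt0// Av.
have Bw b : B b -> dot b w <= 0.
  by move=> Bb; rewrite dotZr pmulr_rle0// Bv.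
pose q (x : 'rV[R]_n.+2) : 'rV[R]_n.+2 := x - dot x w *: w.
have cq : continuous (fun x => `|q x|).
  move=> x; have cd := @dotl_continuous R _ w x.
  have cqx : q @ x --> q x by exact: (cvgB cvg_id (cvgZ cd (cvg_cst w))).
  exact: (cvg_norm cqx).
have [||||M M0 MA] :=
  @compact_penalty1 R _ A (fun x => - `|q x|) (fun x => dot x w) cA => //.
- by move=> x; exact: (cvgN (cq x)).
- exact: dotl_continuous.
- by move=> x Ax; exact/ltW/Aw.
- by move=> x Ax x0; have := Aw x Ax; rewrite x0 ltxx.
(* M + 1 instead of M: the slope has to be defined also when M = 0. *)
have M10 : 0 < M + 1 by rewrite ltr_wpDl.
apply: (@unlinked_graph R n A B w (fun x => (M + 1)^-1 * `|q x|)) => //.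
- split => // [x|t x t0|t x].
  + exact: (cvgM (cvg_cst _) (cq x)).
  + by rewrite /q dotZl -scalerA -scalerBr normrZ ger0_norm// mulrCA.
  + congr (_ * `|_|).
    rewrite /q dotDl dotZl w1 mulr1 scalerDl.
    by rewrite opprD addrACA subrr addr0.
- move=> a Aa; rewrite mulrC ltr_pdivrMr//.
  have := MA a Aa; have := Aw a Aa; move: (dot a w) `|_| => s r; nra.
- move=> b Bb; have := Bw b Bb; rewrite le_eqVlt => /predU1P[bw|bw].
    rewrite bw mulr_gt0 ?invr_gt0// normr_gt0 /q bw scale0r subr0.
    exact: usphere_neq0 (sB b Bb).
  by apply: (lt_le_trans bw); rewrite mulr_ge0// invr_ge0 ltW.
Qed.

Lemma perp_neq0 (R : realType) (n : nat) (A B : set 'rV[R]_n.+2) :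
  compact A -> A !=set0 -> A `<=` usphere R n.+1 -> B `<=` usphere R n.+1 ->
  (forall a b, A a -> B b -> dot a b <= 0) ->
  ~ @unlinked R n.+1 A B -> perp A B !=set0.
Proof.
move=> cA A0 sA sB AB; apply: contra_notP => p0.
have [|y Ay] := @perp_half_space R _ A B 0 cA AB.
  by move=> a pa; exfalso; apply: p0; exists a.
exact: half_space_unlinked cA A0 sA sB AB Ay.
Qed.

(** A point x of A orthogonal to a and to all of B would be a or -a, which is
    not orthogonal to a. So the part of A orthogonal to a has no point
    orthogonal to B, and [perp_half_space] applies to it with the zero form. *)
Lemma poles_separation (R : realType) (n : nat) (A B : set 'rV[R]_n)
    (a : 'rV[R]_n) :
  compact A -> (forall x y, A x -> B y -> dot x y <= 0) -> dot a a = 1 ->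
  (forall x, perp A B x -> x = a \/ x = - a) ->
  exists w : 'rV[R]_n, (forall x, A x -> dot x a = 0 -> 0 < dot x w) /\
    (forall y, B y -> dot y w <= 0).
Proof.
move=> cA AB a1 pa; pose A0 := A `&` [set x | dot x a = 0].
have cA0 : compact A0 by exact: closedI_hyperplane_compact.
have A0B x y : A0 x -> B y -> dot x y <= 0 by move=> [Ax _]; exact: AB.
have [|y Ay] := @perp_half_space R n A0 B 0 cA0 A0B.
  move=> x [[Ax /= xa] xB]; exfalso.
  have /eqP := oner_eq0 R; apply; rewrite -a1 -xa.
  have [->//|xE] : x = a \/ x = - a by apply: pa.
  by move: xa; rewrite xE !dotNl a1 => /eqP; rewrite oppr_eq0 oner_eq0.
have [w [Aw Bw]] := polar_functional cA0 Ay A0B.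
by exists w; split => // x Ax xa; apply: Aw.
Qed.

(** Since A is orthogonal to b and B to a, the function M (|x.b| - |x.a|) equals
    -M |x.a| on A and M |x.b| on B. It decides the sign of x.w - H(x) wherever
    it is large, and near its zeros on either curve x.w has the right sign. *)
Lemma poles_unlinked (R : realType) (n : nat) (A B : set 'rV[R]_n.+3)
    (a b : 'rV[R]_n.+3) :
  compact A -> compact B -> A `<=` usphere R n.+2 -> B `<=` usphere R n.+2 ->
  (forall x y, A x -> B y -> dot x y <= 0) ->
  perp A B a -> perp B A b ->
  (forall x, perp A B x -> x = a \/ x = - a) ->
  (forall y, perp B A y -> y = b \/ y = - b) ->
  @unlinked R n.+2 A B.
Proof.
move=> cA cB sA sB AB [Aa aB] [Bb bA] pa pb.
have a1 : dot a a = 1 by exact: sA.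
have b1 : dot b b = 1 by exact: sB.
have ab : dot a b = 0 by exact: aB.
have BA x y : B x -> A y -> dot x y <= 0 by move=> Bx Ay; rewrite dotC AB.
have [w1 [Aw1 Bw1]] := poles_separation cA AB a1 pa.
have [w2 [Bw2 Aw2]] := poles_separation cB BA b1 pb.
(* Each of w1, -w2 separates weakly and is strict on one of the two curves, so
   the sum is strict on both. Removing the components along a and b does not
   change the values on the points concerned, which are orthogonal to a and b. *)
pose v0 := w1 - w2; pose v := v0 - dot v0 a *: a - dot v0 b *: b.
have va : dot v a = 0.
  by rewrite !dotBl !dotZl a1 (dotC b) ab mulr0 mulr1 subr0 subrr.
have vb : dot v b = 0.
  by rewrite !dotBl !dotZl b1 ab mulr0 mulr1 subr0 subrr.
have vE x : dot x a = 0 -> dot x b = 0 -> dot x v = dot x w1 - dot x w2.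
  by move=> xa xb; rewrite !dotBr !dotZr xa xb !mulr0 !subr0.
have Av x : A x -> dot x a = 0 -> 0 < dot x v.
  move=> Ax xa; rewrite vE// ?subr_gt0; last by rewrite dotC bA.
  by rewrite (le_lt_trans (Aw2 x Ax))// Aw1.
have Bv y : B y -> dot y b = 0 -> dot y v < 0.
  move=> By yb; rewrite vE// ?subr_lt0; last by rewrite dotC aB.
  by rewrite (le_lt_trans (Bw1 y By))// Bw2.
have [w [w_1 wa wb Aw Bw]] : exists w, [/\ dot w w = 1, dot w a = 0, dot w b = 0,
    (forall x, A x -> dot x a = 0 -> 0 < dot x w) &
    (forall y, B y -> dot y b = 0 -> dot y w < 0)].
  (* If v = 0, no point of A is orthogonal to a and no point of B to b, so any
     unit vector orthogonal to a and b will do. *)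
  have [v00|vn0] := eqVneq v 0.
    have [w w_1 /mulmx_tr_col[/mulmx_tr_eq0 wa /mulmx_tr_eq0 wb]] :=
      @exists_unit_perp R (1 + 1) n.+2 (col_mx a b) isT.
    exists w; split => // [x Ax xa|y By yb].
      by have := Av x Ax xa; rewrite v00 dotC dot0l ltxx.
    by have := Bv y By yb; rewrite v00 dotC dot0l ltxx.
  have k0 : 0 < (Num.sqrt (dot v v))^-1 by rewrite invr_gt0 sqrt_dot_gt0.
  exists (unitize v); split.
  - exact: dot_unitize.
  - by rewrite dotZl va mulr0.
  - by rewrite dotZl vb mulr0.
  - by move=> x Ax xa; rewrite dotZr mulr_gt0// Av.
  - by move=> y By yb; rewrite dotZr pmulr_rlt0// Bv.
have cw := @dotl_continuous R _ w.
have cnorm c : continuous (fun x : 'rV[R]_n.+3 => `|dot x c|).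
  by move=> x; exact: (cvg_norm (@dotl_continuous R _ c x)).
have [||||M1 M10 M1A] :=
  @compact_penalty1 R _ A (fun x => dot x w) (fun x => `|dot x a|) cA => //.
  by move=> x Ax /eqP; rewrite normr_eq0 => /eqP; exact: Aw.
have [||||M2 M20 M2B] :=
  @compact_penalty1 R _ B (fun x => dot x (- w)) (fun x => `|dot x b|) cB => //.
- exact: dotl_continuous.
- move=> x Bx /eqP; rewrite normr_eq0 dotNr oppr_gt0 => /eqP; exact: Bw.
pose H x := (M1 + M2) * (`|dot x b| - `|dot x a|).
apply: (@unlinked_graph R n.+1 A B w H) => //.
- split => // [x|t x t0|t x].
  + exact: (cvgM (cvg_cst _) (cvgB (cnorm b x) (cnorm a x))).
  + by rewrite /H !dotZl !normrM ger0_norm// -mulrBr mulrCA.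
  + by rewrite /H !dotDl !dotZl wa wb mulr0 !addr0.
- move=> x Ax; rewrite /H (dotC x b) bA// normr0 sub0r.
  have := M1A x Ax; have := normr_ge0 (dot x a).
  by move: (dot x w) `|_| => s r r0 h; nra.
- move=> x Bx; rewrite /H (dotC x a) aB// normr0 subr0.
  have := M2B x Bx; have := normr_ge0 (dot x b); rewrite dotNr.
  by move: (dot x w) `|_| => s r r0 h; nra.
Qed.

Lemma linked_dual_circles (R : realType) (A B : set 'rV[R]_4) :
  @jordan_curve R 3 A -> @jordan_curve R 3 B -> @linked R 3 A B ->
  (forall a b, A a -> B b -> dot a b <= 0) -> dual_circles A B.
Proof.
move=> jA jB lAB AB.
have BA x y : B x -> A y -> dot x y <= 0 by move=> Bx Ay; rewrite dotC AB.
have lBA : @linked R 3 B A by move=> /unlinked_sym.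
have cA := jordan_curve_compact jA; have cB := jordan_curve_compact jB.
have sA := jA.1; have sB := jB.1.
have [a pa] := perp_neq0 cA (jordan_curve_neq0 jA) sA sB AB lAB.
have [b pb] := perp_neq0 cB (jordan_curve_neq0 jB) sB sA BA lBA.
have [pbE|/existsNP[c /not_implyP[pc /not_orP[cb cNb]]]] :=
  pselect (forall y, perp B A y -> y = b \/ y = - b); last first.
  exact: (dual_circles_of_perp jA jB AB pa pb pc cb cNb).
have [paE|/existsNP[c /not_implyP[pc /not_orP[ca cNa]]]] :=
  pselect (forall x, perp A B x -> x = a \/ x = - a); last first.
  apply: dual_circles_sym.
  exact: (dual_circles_of_perp jB jA BA pb pa pc ca cNa).
by exfalso; apply: lAB; exact: (poles_unlinked cA cB sA sB AB pa pb paE pbE).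
Qed.

(** * The angular distance *)

Lemma angdist_ge_pihalf (R : realType) (n : nat) (x y : 'rV[R]_n.+1) :
  usphere R n x -> usphere R n y -> pi / 2 <= angdist x y -> dot x y <= 0.
Proof.
move=> x1 y1; have xy := usphere_dot_itv x1 y1; rewrite /angdist => xy_obtuse.
rewrite leNgt; apply/negP => xy0; move: xy_obtuse; rewrite leNgt => /negP; apply.
have pi0 := pi_ge0 R.
rewrite -ltr_cos ?in_itv/= ?acos_ge0 ?acos_lepi//; last first.
  by apply/andP; split; lra.
by rewrite acosK ?in_itv// cos_pihalf.
Qed.

Lemma setdist_le_angdist (R : realType) (n : nat) (A B : set 'rV[R]_n.+1)
    (a b : 'rV[R]_n.+1) :
  A `<=` usphere R n -> B `<=` usphere R n -> A a -> B b ->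
  setdist A B <= angdist a b.
Proof.
move=> sA sB Aa Bb; apply: ge_inf; last by exists a, b.
exists 0 => _ [x [y [Ax By ->]]].
exact/acos_ge0/usphere_dot_itv/sB/By/sA.
Qed.

Lemma setdist_orthogonal (R : realType) (n : nat) (A B : set 'rV[R]_n) :
  A !=set0 -> B !=set0 -> (forall a b, A a -> B b -> dot a b = 0) ->
  setdist A B = pi / 2.
Proof.
move=> [a0 Aa0] [b0 Bb0] AB; rewrite /setdist.
have dist a b : A a -> B b -> angdist a b = pi / 2.
  by move=> Aa Bb; rewrite /angdist AB// acos0.
rewrite (_ : mkset _ = [set pi / 2]) ?inf1//.
apply/seteqP; split => [_ [a [b [Aa Bb ->]]]|_ ->]; first exact: dist.
by exists a0, b0; rewrite dist.
Qed.

Theorem theorem1p2 (R : realType) (A B : set 'rV[R]_4)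
    (hA : @jordan_curve R 3 A) (hB : @jordan_curve R 3 B)
    (hdisj : A `&` B = set0) (hlinked : @linked R 3 A B) :
  setdist A B <= pi / 2 /\
  (setdist A B = pi / 2 <->
   exists P : {vspace 'rV[R]_4},
     [/\ (\dim P = 2)%N,
         A = usphere R 3 `&` [set x | x \in P] &
         B = usphere R 3 `&` orthocomp P]).
Proof.
have distP (P : {vspace 'rV[R]_4}) : A = usphere R 3 `&` [set x | x \in P] ->
    B = usphere R 3 `&` orthocomp P -> setdist A B = pi / 2.
  move=> AP BP; apply: setdist_orthogonal; try exact: jordan_curve_neq0.
  by move=> a b; rewrite AP BP => -[_ aP] [_ bP]; exact: bP.
have rigid : pi / 2 <= setdist A B -> exists P : {vspace 'rV[R]_4},
    [/\ (\dim P = 2)%N, A = usphere R 3 `&` [set x | x \in P] &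
        B = usphere R 3 `&` orthocomp P].
  move=> dAB; apply/dual_circles_vspace/linked_dual_circles => // a b Aa Bb.
  apply: angdist_ge_pihalf; [exact: hA.1|exact: hB.1|].
  exact: le_trans dAB (setdist_le_angdist hA.1 hB.1 Aa Bb).
split; last by split => [dAB|[P [_ AP BP]]]; [apply: rigid; rewrite dAB|exact: distP BP].
rewrite leNgt; apply/negP => dAB.
have [P [_ AP BP]] := rigid (ltW dAB).
by move: dAB; rewrite (distP P AP BP) ltxx.
Qed.
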